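(* Let $M$ be a pointed metric space with set of cluster points $M'$. If $M'$ is infinite, then $\mathrm{Lip}_0(M)$ has the sequential strong diameter two property.
   Context: All Banach spaces are real; $S_X$ denotes the unit sphere of $X$. A pointed metric space is a metric space $(M,d)$ with a distinguished point $0\in M$. $\mathrm{Lip}_0(M)$ is the Banach space of all Lipschitz functions $f:M\to\mathbb R$ with $f(0)=0$, with norm $\Vert f\Vert:=\sup_{x\ne y\in M}\frac{f(x)-f(y)}{d(x,y)}$. A Banach space $X$ has the sequential strong diameter two property (sequential SD2P) if, for every $m\in\mathbb N$ and every $x_1,\ldots,x_m\in S_X$, there are sequences $\{y_n^i\}_n$ ($1\le i\le m$) and $\{z_n\}_n$ in $S_X$ such that: for every $i$, the sequence $\{x_i-y_n^i\}_n$ is either norm-null or equivalent to the $c_0$ basis; $\{z_n\}_n$ is equivalent to the $c_0$ basis; and $\Vert y_n^i\pm z_n\Vert\to 1$ as $n\to\infty$ for every $i\in\{1,\ldots,m\}$. Here a sequence $\{u_n\}$ is equivalent to the $c_0$ basis if there are constants $0<a\le b$ such that $a\max_{j\le p}|\lambda_j|\le\Vert\sum_{j=1}^p\lambda_ju_j\Vert\le b\max_{j\le p}|\lambda_j|$ for all $p\in\mathbb N$ and $\lambda_1,\ldots,\lambda_p\in\mathbb R$. *)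

(* Defs.v *)
From HB Require Import structures.
From mathcomp Require Import all_boot all_order all_algebra.
From mathcomp Require Import all_classical all_reals topology normedtype.
From mathcomp Require Import sequences.

Set Implicit Arguments.
Unset Strict Implicit.
Unset Printing Implicit Defensive.

From mathcomp Require Import ring.

Import Order.TTheory GRing.Theory Num.Theory.
Import numFieldNormedType.Exports.

Local Open Scope classical_set_scope.
Local Open Scope ring_scope.

Section Lip0.
Context {R : realType} {M : metricType R}.

Definition lipschitz_fun (f : M -> R) : Prop :=
  exists k : R, forall x y, `|f x - f y| <= k * mdist x y.

Definition lip0_pred (o : M) : {pred M -> R} :=
  [pred f | `[< lipschitz_fun f /\ f o = 0 >] ].

(* Lip_0(M), with [o] as the distinguished point of M. *)
Record lip0 (o : M) : Type := Lip0 {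
  lip0_val :> M -> R;
  lip0_valP : lip0_val \in lip0_pred o }.

Variable o : M.

HB.instance Definition _ := [isSub for @lip0_val o].
HB.instance Definition _ := [Choice of lip0 o by <:].

Let lip0_closed : submod_closed (lip0_pred o).
Proof.
split.
  apply/asboolP; split => //; exists 0 => x y.
  by rewrite subrr normr0 mul0r.
move=> a f g /asboolP[[k kf] f0] /asboolP[[l lg] g0].
apply/asboolP; split; last first.
  by rewrite !fctE f0 g0 scaler0 addr0.
exists (`|a| * k + l) => x y; rewrite !fctE opprD addrACA -scalerBr.
rewrite (le_trans (ler_normD _ _))// mulrDl lerD//.
by rewrite normrZ -mulrA ler_wpM2l.
Qed.

HB.instance Definition _ :=
  GRing.isSubmodClosed.Build _ _ (lip0_pred o) lip0_closed.
HB.instance Definition _ := [SubChoice_isSubLmodule of lip0 o by <:].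

Definition lip_slopes (f : M -> R) : set R :=
  [set r | exists x y, x != y /\ r = (f x - f y) / mdist x y].

(* On a one-point space there are no slopes, and [sup set0 = 0]. *)
Definition lip0_norm (f : lip0 o) : R := sup (lip_slopes f).

Lemma lip0_has_ubound (f : lip0 o) : has_ubound (lip_slopes f).
Proof.
have /asboolP[[k kf] _] := lip0_valP f.
exists k => _ [x [y [xy ->]]]; rewrite ler_pdivrMr ?mdist_gt0//.
exact: le_trans (ler_norm _) (kf x y).
Qed.

Lemma lip0_norm_ge0 (f : lip0 o) : 0 <= lip0_norm f.
Proof.
rewrite /lip0_norm; have [->|/set0P[r [x [y [xy rE]]]]] :=
  eqVneq (lip_slopes f) set0; first by rewrite sup0.
have yx : y != x by rewrite eq_sym.
have h1 : r <= sup (lip_slopes f).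
  by apply: ub_le_sup; [exact: lip0_has_ubound|exists x, y].
have h2 : - r <= sup (lip_slopes f).
  apply: ub_le_sup; first exact: lip0_has_ubound.
  by exists y, x; split => //; rewrite rE -mulNr opprB metric_sym.
by have [r0|r0] := leP 0 r; [apply: le_trans h1|apply: le_trans h2;
  rewrite oppr_ge0 ltW].
Qed.

Lemma lip0_norm_lip (f : lip0 o) x y :
  `|f x - f y| <= lip0_norm f * mdist x y.
Proof.
have [->|xy] := eqVneq x y; first by rewrite subrr normr0 mdistxx mulr0.
have slope (u v : M) : u != v -> f u - f v <= lip0_norm f * mdist u v.
  move=> uv; rewrite -ler_pdivrMr ?mdist_gt0//.
  by apply: ub_le_sup; [exact: lip0_has_ubound|exists u, v].
rewrite ler_norml slope// andbT lerNl opprB metric_sym slope//.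
by rewrite eq_sym.
Qed.

Lemma lip0_norm_le (f : lip0 o) (k : R) : 0 <= k ->
  (forall x y, `|f x - f y| <= k * mdist x y) -> lip0_norm f <= k.
Proof.
move=> k0 fk; rewrite /lip0_norm.
have [->|/set0P s0] := eqVneq (lip_slopes f) set0; first by rewrite sup0.
apply: ge_sup => //.
move=> _ [x [y [xy ->]]]; rewrite ler_pdivrMr ?mdist_gt0//.
exact: le_trans (ler_norm _) (fk x y).
Qed.

Lemma lip0_base (f : lip0 o) : f o = 0.
Proof. by have /asboolP[] := lip0_valP f. Qed.

Lemma lip0_normD (f g : lip0 o) :
  lip0_norm (f + g) <= lip0_norm f + lip0_norm g.
Proof.
apply: lip0_norm_le; first by rewrite addr_ge0 ?lip0_norm_ge0.
move=> x y; rewrite -[lip0_val (f + g)]/(val (f + g)) raddfD/= !fctE.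
rewrite opprD addrACA mulrDl (le_trans (ler_normD _ _))//.
by rewrite lerD// lip0_norm_lip.
Qed.

Let lip0_normZ_le (a : R) (f : lip0 o) :
  lip0_norm (a *: f) <= `|a| * lip0_norm f.
Proof.
apply: lip0_norm_le; first by rewrite mulr_ge0 ?lip0_norm_ge0.
move=> x y; rewrite -[lip0_val (a *: f)]/(val (a *: f)) linearZ/= !fctE.
by rewrite -scalerBr normrZ -mulrA ler_wpM2l// lip0_norm_lip.
Qed.

Lemma lip0_normZ (a : R) (f : lip0 o) :
  lip0_norm (a *: f) = `|a| * lip0_norm f.
Proof.
apply/eqP; rewrite eq_le lip0_normZ_le/=.
have [->|a0] := eqVneq a 0; first by rewrite normr0 mul0r lip0_norm_ge0.
rewrite -ler_pdivlMl ?normr_gt0//.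
rewrite -[in leLHS](scalerK a0 f) -normfV; exact: lip0_normZ_le.
Qed.

Lemma lip0_norm_eq0 (f : lip0 o) : lip0_norm f = 0 -> f = 0.
Proof.
move=> f0; apply/val_inj/funext => x.
have := lip0_norm_lip f x o; rewrite f0 mul0r lip0_base subr0 normr_le0.
by move/eqP => fx; rewrite -[RHS]/(val (0 : lip0 o) x) raddf0.
Qed.

HB.instance Definition _ :=
  Lmodule_isNormed.Build R (lip0 o) lip0_normD lip0_normZ lip0_norm_eq0.

Lemma lip0_normE (f : lip0 o) : `|f| = lip0_norm f.
Proof. by []. Qed.

Let lip0B (f g : lip0 o) x : (f - g) x = f x - g x.
Proof. by rewrite -[lip0_val (f - g)]/(val (f - g)) raddfB. Qed.

Let lip0_pt (f g : lip0 o) x : `|f x - g x| <= `|f - g| * mdist x o.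
Proof.
have := lip0_norm_lip (f - g) x o.
by rewrite !lip0B !lip0_base subrr subr0.
Qed.

Let lip0_complete (F : set_system (lip0 o)) :
  ProperFilter F -> cauchy F -> cvg F.
Proof.
move=> FF /cauchyP Fc.
pose ev x (f : lip0 o) : R := f x.
have ev_cvg x : cvg (ev x @ F).
  apply: cauchy_cvg; apply/cauchyP => e e0 /=.
  have d0 : 0 < mdist x o + 1 by rewrite ltr_wpDl ?mdist_ge0.
  have [g Fg] := Fc (e / (mdist x o + 1)) (divr_gt0 e0 d0).
  exists (g x); apply: filterS Fg => f /=; rewrite -ball_normE /= => fg.
  rewrite /ball/=; apply: le_lt_trans (lip0_pt g f x) _.
  move: fg; rewrite ltr_pdivlMr//; apply: le_lt_trans.
  by rewrite ler_wpM2l// lerDl.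
pose l x := lim (ev x @ F).
have l_near (g : lip0 o) (e : R) : F (ball g e) -> forall x y,
    `|(l x - g x) - (l y - g y)| <= e * mdist x y.
  move=> Fg x y.
  have : (fun f : lip0 o => `|(f x - g x) - (f y - g y)|) @ F -->
      `|(l x - g x) - (l y - g y)|.
    apply: cvg_norm; apply: cvgB.
      by apply: cvgB; [exact: ev_cvg|exact: cvg_cst].
    by apply: cvgB; [exact: ev_cvg|exact: cvg_cst].
  move/cvgr_to_le; apply; apply: filterS Fg => f; rewrite -ball_normE /= => fg.
  have := lip0_norm_lip (f - g) x y; rewrite !lip0B => /le_trans; apply.
  by rewrite ler_wpM2r ?mdist_ge0// -lip0_normE distrC ltW.
have lP : l \in lip0_pred o.
  apply/asboolP; split.
    have [g /l_near lg] := Fc 1 ltr01; exists (1 + lip0_norm g) => x y.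
    have -> : l x - l y = (l x - g x) - (l y - g y) + (g x - g y).
      by ring.
    rewrite mulrDl (le_trans (ler_normD _ _))// lerD// lip0_norm_lip //.
  have : ev o @ F --> (0 : R).
    rewrite (_ : ev o = fun=> 0); first exact: cvg_cst.
    by apply/funext => f; rewrite /ev lip0_base.
  by move/cvg_lim => <-.
apply/cvg_ex; exists (Lip0 lP); apply/cvgrPdist_le => e e0.
have e20 : 0 < e / 2 by rewrite divr_gt0.
have [g Fg] := Fc _ e20.
have lg : `|Lip0 lP - g| <= e / 2.
  apply: lip0_norm_le; first exact: ltW.
  by move=> x y; rewrite !lip0B; exact: l_near.
apply: filterS Fg => f; rewrite -ball_normE /= => fg.
rewrite [e]splitr -(subrK g (Lip0 lP)) -addrA.
by rewrite (le_trans (ler_normD _ _))// lerD// ltW.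
Qed.

HB.instance Definition _ := Uniform_isComplete.Build (lip0 o) lip0_complete.

End Lip0.

Section Sequential_SD2P.
Context {R : realType}.

Definition unit_sphere (X : normedModType R) : set X := [set x | `|x| = 1].
Arguments unit_sphere X : clear implicits.

(* The initial value [0] of the maxima only matters for [p = 0], since [`|c j| >= 0]. *)
Definition c0_equivalent (X : normedModType R) (u : nat -> X) : Prop :=
  exists a b : R, [/\ 0 < a, a <= b &
    forall (p : nat) (c : 'I_p -> R),
      a * \big[Num.max/0]_(j < p) `|c j| <= `|\sum_(j < p) c j *: u j|
      <= b * \big[Num.max/0]_(j < p) `|c j|].

(* [m] ranges over the positive integers: on the zero space, whose unit sphere
   is empty, the case [m = 0] would fail while all the others hold vacuously. *)
Definition sequential_SD2P (X : completeNormedModType R) : Prop :=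
  forall (m : nat) (x : 'I_m -> X), (0 < m)%N ->
    (forall i, unit_sphere X (x i)) ->
    exists (y : 'I_m -> nat -> X) (z : nat -> X),
      [/\ (forall i n, unit_sphere X (y i n)) /\ (forall n, unit_sphere X (z n)),
          forall i, (x i - y i n @[n --> \oo] --> (0 : X)) \/
                    c0_equivalent (fun n => x i - y i n),
          c0_equivalent z &
          forall i, (`|y i n + z n| @[n --> \oo] --> (1 : R)) /\
                    (`|y i n - z n| @[n --> \oo] --> (1 : R))].

End Sequential_SD2P.

(* Main.v *)
Require Import Defs.
From mathcomp Require Import all_boot all_order all_algebra.
From mathcomp Require Import all_classical all_reals topology normedtype.
From mathcomp Require Import sequences.
From mathcomp Require Import lra ring.

Set Implicit Arguments.
Unset Strict Implicit.
Unset Printing Implicit Defensive.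

Import Order.TTheory GRing.Theory Num.Theory.
Import numFieldNormedType.Exports.

Local Open Scope classical_set_scope.
Local Open Scope ring_scope.

(** Infinitely many cluster points give infinitely many pairwise disjoint balls
    [B n], centred at cluster points [p n] and missing the base point
    ([infinite_disjoint_balls]). Everything happens separately in these balls.

    In one ball ([one_ball_surgery]), with small slack [e], a 1-Lipschitz [f] is
    first flattened: clamping it between [f p] plus and minus a function of the
    distance to [p], which vanishes near [p] and is at least that distance
    outside the ball, gives a [(1 + e)]-Lipschitz function, constant near [p] and equal
    to [f] outside the ball. On the constant part sits a much smaller plateau of
    slope 1, and on the top of the plateau a still smaller cone [z] of norm 1.
    These three functions live at such different scales that their slopes do not
    add up: the sum still has norm close to 1 ([lipschitz_by_add_local]). So
    [g], the flattened function plus the plateau, satisfies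
    [|g|, |g + z|, |g - z| <= 1 + e], while the plateau forces [1 <= |g|], hence
    [1 - e <= |g + z|, |g - z|] by convexity. The plateau is given the sign for
    which [f - g] has a slope at least 1 inside the ball. As [z] depends only on
    [p], the radius and [e], it serves all functions [f] at once.

    Bounded functions with disjoint supports and with a slope at least 1 inside
    each support span [c_0] ([disjoint_bumps_c0]): a pair of points meets at most
    two supports, and each coefficient is seen by a pair inside its own support.
    This applies to the [z n] and to [x i - g n i]. Finally [g n i] is normalized
    to [y n i]; the error is at most [2^-(n+2)], which is summable with sum below
    the lower [c_0] constant, and so is harmless ([c0_equivalent_perturb]). *)

(** * Disjoint balls around infinitely many points *)

Section DisjointBalls.
Context {R : realType} {M : metricType R}.
Implicit Types (A : set M) (p o : M) (e r : R).

Lemma infinite_two_points A : infinite_set A ->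
  exists a b, [/\ A a, A b & a != b].
Proof.
move=> infA.
have [a Aa] : A !=set0.
  by apply/set0P/eqP => A0; apply: infA; rewrite A0; exact: finite_set0.
have [b [Ab ba]] : exists b, A b /\ b != a.
  apply: contrapT => nb; apply: infA.
  apply: sub_finite_set (finite_set1 a) => b Ab /=.
  by apply: contrapT => ba; apply: nb; exists b; split => //; apply/eqP.
by exists a, b; rewrite eq_sym.
Qed.

(** Two balls of radius [2 * r] around two points of [A] at distance at least
    [4 * r] are disjoint, so at least one of them leaves infinitely many points
    of [A] outside. *)
Lemma infinite_setD_ball A o e : infinite_set A -> ~ A o -> 0 < e ->
  exists p r, [/\ A p, 0 < r, r <= e, r <= mdist p o &
    infinite_set (A `&` [set x | 2 * r <= mdist x p])].
Proof.
move=> infA Ao e0; have [a [b [Aa Ab ab]]] := infinite_two_points infA.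
have ao : 0 < mdist a o.
  by rewrite mdist_gt0; apply/eqP => aE; apply: Ao; rewrite -aE.
have bo : 0 < mdist b o.
  by rewrite mdist_gt0; apply/eqP => bE; apply: Ao; rewrite -bE.
have dab : 0 < mdist a b by rewrite mdist_gt0.
pose r := Num.min (Num.min e (mdist a b / 4)) (Num.min (mdist a o) (mdist b o)).
have [r0 re rab ra rb] :
    [/\ 0 < r, r <= e, r <= mdist a b / 4, r <= mdist a o & r <= mdist b o].
  by rewrite /r !lt_min !ge_min !lexx ?orbT e0 ao bo divr_gt0.
have cover : A `<=` (A `&` [set x | 2 * r <= mdist x a]) `|`
                    (A `&` [set x | 2 * r <= mdist x b]).
  move=> x Ax; have [xa|xa] := leP (2 * r) (mdist x a); first by left.
  right; split => //=; have := metric_triangle a x b; rewrite (metric_sym a x).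
  lra.
have [fa|infa] := pselect (finite_set (A `&` [set x | 2 * r <= mdist x a])).
  exists b, r; split => // fb; apply: infA; apply: sub_finite_set cover _.
  by rewrite finite_setU.
by exists a, r.
Qed.

(** Iterating [infinite_setD_ball] with decreasing radii: each later centre is
    at distance at least twice the earlier radius from each earlier one, and the
    later radius is not larger. *)
Lemma infinite_disjoint_balls A o : infinite_set A ->
  exists (p : nat -> M) (r : nat -> R),
    [/\ forall n, A (p n), forall n, 0 < r n, forall n, r n <= mdist (p n) o &
      forall i j x, mdist x (p i) < r i -> mdist x (p j) < r j -> i = j].
Proof.
move=> infA.
(* A state is the infinite set still available, with the last ball chosen. *)
pose good (s : set M * (M * R)) := [/\ infinite_set s.1,
  s.1 `<=` (A `\ o) `&` [set x | 2 * s.2.2 <= mdist x s.2.1],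
  A s.2.1, 0 < s.2.2 & s.2.2 <= mdist s.2.1 o].
have step A' e : infinite_set A' -> A' `<=` A `\ o -> 0 < e ->
    {t | [/\ good t, t.1 `<=` A', A' t.2.1 & t.2.2 <= e]}.
  move=> infA' A'A e0; apply: cid.
  have A'o : ~ A' o by move/A'A => -[_]; apply.
  have [p [r [A'p r0 re rpo inf]]] := infinite_setD_ball infA' A'o e0.
  exists (A' `&` [set x | 2 * r <= mdist x p], (p, r)); split => //=.
  - split => //= [x [/A'A Ax xp]|]; first by split.
    by have [] := A'A _ A'p.
have infAo : infinite_set (A `\ o).
  move=> fAo; apply: infA.
  apply: sub_finite_set (_ : finite_set ((A `\ o) `|` [set o])).
    by move=> x Ax; have [->|/eqP xo] := eqVneq x o; [right|left].
  by rewrite finite_setU; split => //; exact: finite_set1.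
have [s0 [s0good _ _ _]] := step _ _ infAo (fun x h => h) ltr01.
have next (s : {s | good s}) : {t : {s | good s} |
    [/\ (sval t).1 `<=` (sval s).1, (sval s).1 (sval t).2.1 &
        (sval t).2.2 <= (sval s).2.2]}.
  case: s => s [infs sA _ sr0 _] /=.
  have sA' : s.1 `<=` A `\ o by move=> x /sA[].
  have [t [tgood ts tp tr]] := step _ _ infs sA' sr0.
  by exists (exist _ t tgood).
have [u [_ uS]] := dependent_choice next (exist _ s0 s0good).
have uA i j : (i <= j)%N -> (sval (u j)).1 `<=` (sval (u i)).1.
  elim: j => [|j IH]; first by rewrite leqn0 => /eqP ->.
  rewrite leq_eqVlt => /orP[/eqP ->//|]; rewrite ltnS => /IH.
  by move=> h; apply: subset_trans h; have [] := uS j.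
have ur i j : (i <= j)%N -> (sval (u j)).2.2 <= (sval (u i)).2.2.
  elim: j => [|j IH]; first by rewrite leqn0 => /eqP ->.
  rewrite leq_eqVlt => /orP[/eqP ->//|]; rewrite ltnS => /IH.
  by move=> h; apply: le_trans h; have [] := uS j.
pose p n := (sval (u n)).2.1; pose r n := (sval (u n)).2.2.
exists p, r; split => [n|n|n|].
- by rewrite /p; case: (svalP (u n)).
- by rewrite /r; case: (svalP (u n)).
- by rewrite /p /r; case: (svalP (u n)).
have disj i j x : (i < j)%N -> mdist x (p i) < r i -> ~ mdist x (p j) < r j.
  case: j => // j; rewrite ltnS => ij xi xj.
  have /(uA _ _ ij) : (sval (u j)).1 (p j.+1) by have [] := uS j.
  case: (svalP (u i)) => _ h _ _ _ /h[_] /=; rewrite -/(p i) -/(r i).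
  have := ur _ _ (leqW ij); rewrite -/(r i) -/(r j.+1).
  have := metric_triangle (p j.+1) x (p i); rewrite (metric_sym _ x).
  lra.
move=> i j x xi xj; have [ij|ji|//] := ltngtP i j.
- by have := disj _ _ _ ij xi xj.
- by have := disj _ _ _ ji xj xi.
Qed.

End DisjointBalls.

(** * Adding functions that vary at different scales *)

Section Surgery.
Context {R : realType} {M : metricType R}.
Implicit Types (f g u v w z : M -> R) (p o x y : M) (k e r : R).

Definition lipschitz_by k f := forall x y, `|f x - f y| <= k * mdist x y.

Lemma lipschitz_byW k l f : k <= l -> lipschitz_by k f -> lipschitz_by l f.
Proof.
by move=> kl kf x y; rewrite (le_trans (kf x y))// ler_wpM2r// mdist_ge0.
Qed.

Lemma lipschitz_by_sym k f : (forall x y, f x - f y <= k * mdist x y) ->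
  lipschitz_by k f.
Proof. by move=> kf x y; rewrite ler_norml kf andbT lerNl opprB metric_sym. Qed.

Lemma lipschitz_by_max k f g : lipschitz_by k f -> lipschitz_by k g ->
  lipschitz_by k (fun x => Num.max (f x) (g x)).
Proof.
move=> kf kg; apply: lipschitz_by_sym => x y; rewrite lerBlDr ge_max.
have /ler_normlP[_ h1] := kf x y; have /ler_normlP[_ h2] := kg x y.
have : f y <= Num.max (f y) (g y) by rewrite le_max lexx.
have : g y <= Num.max (f y) (g y) by rewrite le_max lexx orbT.
by move=> ? ?; apply/andP; split; lra.
Qed.

Lemma lipschitz_byN k f : lipschitz_by k f -> lipschitz_by k (fun x => - f x).
Proof. by move=> kf x y; rewrite -opprD normrN. Qed.

Lemma lipschitz_by_min k f g : lipschitz_by k f -> lipschitz_by k g ->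
  lipschitz_by k (fun x => Num.min (f x) (g x)).
Proof.
move=> kf kg.
have := lipschitz_byN (lipschitz_by_max (lipschitz_byN kf) (lipschitz_byN kg)).
by under [X in lipschitz_by _ X]eq_fun do rewrite oppr_max !opprK.
Qed.

(** If [v] lives well inside the ball on which [u] is constant, the slopes of
    [u] and [v] do not add up: a pair of points on which both vary is at distance
    at least [r1 - r2], compared with which [v] is small. *)
Lemma lipschitz_by_add_local k e r1 r2 p u v : 0 <= e ->
  lipschitz_by k u -> lipschitz_by k v ->
  (forall x, mdist x p <= r1 -> u x = u p) ->
  (forall x, r2 <= mdist x p -> v x = 0) ->
  (forall x, `|v x| <= e * (r1 - r2)) ->
  r2 <= r1 ->
  lipschitz_by (k + e) (fun x => u x + v x).
Proof.
move=> e0 ku kv uc v0 vb r21 x y.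
have ke t : k * t <= (k + e) * t <-> 0 <= e * t by rewrite mulrDl lerDl.
have mixed a b : mdist a p <= r2 -> r1 <= mdist b p ->
    `|(u a + v a) - (u b + v b)| <= (k + e) * mdist a b.
  move=> ap bp; rewrite (v0 b) ?(le_trans r21)// addr0 addrAC.
  rewrite mulrDl (le_trans (ler_normD _ _))// lerD//.
  apply: le_trans (vb a) _; apply: ler_wpM2l => //.
  have := metric_triangle b a p; rewrite (metric_sym b a); lra.
have far a b : r2 <= mdist a p -> r2 <= mdist b p ->
    `|(u a + v a) - (u b + v b)| <= (k + e) * mdist a b.
  move=> /v0 -> /v0 ->; rewrite !addr0.
  by apply: le_trans (ku a b) _; apply/ke; rewrite mulr_ge0 ?mdist_ge0.
have near a b : mdist a p <= r1 -> mdist b p <= r1 ->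
    `|(u a + v a) - (u b + v b)| <= (k + e) * mdist a b.
  move=> /uc -> /uc ->; rewrite opprD addrACA subrr add0r.
  by apply: le_trans (kv a b) _; apply/ke; rewrite mulr_ge0 ?mdist_ge0.
have [xr|/ltW xr] := leP (mdist x p) r1; have [yr|/ltW yr] := leP (mdist y p) r1.
- exact: near.
- have [xr2|/ltW xr2] := leP (mdist x p) r2; first exact: mixed.
  by apply: far => //; exact: le_trans yr.
- have [yr2|/ltW yr2] := leP (mdist y p) r2; last first.
    by apply: far => //; exact: le_trans xr.
  by rewrite distrC metric_sym mixed.
- by apply: far; [exact: le_trans xr|exact: le_trans yr].
Qed.

Lemma lipschitz_by_comp_dist k p (h : R -> R) : 0 <= k ->
  (forall s t, s <= t -> h t - h s <= k * (t - s)) ->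
  (forall s t, s <= t -> h s - h t <= k * (t - s)) ->
  lipschitz_by k (fun x => h (mdist x p)).
Proof.
move=> k0 h1 h2; apply: lipschitz_by_sym => x y.
have := metric_triangle x y p; have := metric_triangle y x p.
rewrite (metric_sym y x) => t1 t2.
have [xy|/ltW yx] := leP (mdist x p) (mdist y p).
  apply: le_trans (h2 _ _ xy) _; apply: ler_wpM2l => //; lra.
apply: le_trans (h1 _ _ yx) _; apply: ler_wpM2l => //; lra.
Qed.

(** * Surgery in one ball *)

(** Slope [1 + k] instead of 1 is the price for vanishing near 0 and still
    dominating [t] from [r] on. *)
Definition ramp k r (t : R) := Num.max 0 ((1 + k) * t - k * r).

Lemma ramp_lipschitz k r p : 0 < k ->
  lipschitz_by (1 + k) (fun x => ramp k r (mdist x p)).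
Proof.
move=> k0; apply: lipschitz_by_comp_dist => [|s t st|s t st]; first lra.
  rewrite /ramp; case: (leP 0 ((1 + k) * t - _));
    by case: (leP 0 ((1 + k) * s - _)); nra.
rewrite /ramp; case: (leP 0 ((1 + k) * t - _));
  by case: (leP 0 ((1 + k) * s - _)); nra.
Qed.

Lemma ramp_eq0 k r t : (1 + k) * t <= k * r -> ramp k r t = 0.
Proof. by move=> h; apply/max_idPl; lra. Qed.

Lemma ramp_ge k r t : 0 < k -> r <= t -> t <= ramp k r t.
Proof. by move=> k0 h; rewrite /ramp le_max; apply/orP; right; nra. Qed.

Lemma ramp_ge0 k r t : 0 <= ramp k r t.
Proof. by rewrite /ramp le_max lexx. Qed.

(** A 1-Lipschitz [f] differs from [f p] by at most the distance to [p], so the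
    clamping is inactive from distance [r] on. *)
Definition flatten k r p f x :=
  Num.max (Num.min (f x) (f p + ramp k r (mdist x p)))
          (f p - ramp k r (mdist x p)).

Lemma flatten_lipschitz k r p f : 0 < k -> lipschitz_by 1 f ->
  lipschitz_by (1 + k) (flatten k r p f).
Proof.
move=> k0 f1; have rl := @ramp_lipschitz k r p k0.
have fl : lipschitz_by (1 + k) f by apply: lipschitz_byW f1; lra.
have addc a h : lipschitz_by (1 + k) h -> lipschitz_by (1 + k) (fun x => a + h x).
  by move=> hl x y; rewrite opprD addrACA subrr add0r.
apply: lipschitz_by_max; last by apply: addc; exact: lipschitz_byN.
by apply: lipschitz_by_min => //; exact: addc.
Qed.

Lemma flatten_center k r p f x : (1 + k) * mdist x p <= k * r ->
  flatten k r p f x = f p.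
Proof.
move=> h; rewrite /flatten (ramp_eq0 h) addr0 subr0; apply/max_idPr.
by rewrite ge_min lexx orbT.
Qed.

Lemma flatten_out k r p f x : 0 < k -> lipschitz_by 1 f -> r <= mdist x p ->
  flatten k r p f x = f x.
Proof.
move=> k0 f1 h; have := f1 x p; rewrite mul1r ler_norml => /andP[h1 h2].
have := ramp_ge k0 h => h3.
by rewrite /flatten (min_idPl _) ?(max_idPl _)//; lra.
Qed.

(** Equal to [r] near [p] and to 0 from distance [r] on, so that its slope
    between [p] and any point at distance exactly [r] is 1. *)
Definition plateau k r p x := Num.max 0 (r - ramp k r (mdist x p)).

Lemma plateau_lipschitz k r p : 0 < k -> lipschitz_by (1 + k) (plateau k r p).
Proof.
move=> k0; apply: lipschitz_by_max => x y.
  by rewrite subrr normr0 mulr_ge0 ?mdist_ge0//; lra.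
rewrite opprD addrACA subrr add0r.
exact: (lipschitz_byN (@ramp_lipschitz k r p k0)).
Qed.

Lemma plateau_center k r p x : 0 <= r -> (1 + k) * mdist x p <= k * r ->
  plateau k r p x = r.
Proof.
by move=> r0 h; rewrite /plateau ramp_eq0// subr0; apply/max_idPr.
Qed.

Lemma plateau_out k r p x : 0 < k -> r <= mdist x p -> plateau k r p x = 0.
Proof.
by move=> k0 h; apply/max_idPl; have := ramp_ge k0 h; lra.
Qed.

Lemma plateau_le k r p x : 0 <= r -> `|plateau k r p x| <= r.
Proof.
move=> r0; rewrite /plateau ger0_norm ?le_max ?lexx// ge_max r0/=.
by have := ramp_ge0 k r (mdist x p); lra.
Qed.

Lemma limit_point_near p e : limit_point [set: M] p -> 0 < e ->
  exists q, q != p /\ mdist q p <= e.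
Proof.
move=> pl e0; have [q [qp _ qe]] := pl _ (nbhsx_ballx p e e0).
exists q; split => //; move: qe; rewrite ballEmdist /= metric_sym; exact: ltW.
Qed.

(** A cone [z] common to all 1-Lipschitz [f], and for each [f] a modification [g]
    inside the ball that leaves room for it. *)
Lemma one_ball_surgery p r e : limit_point [set: M] p -> 0 < r -> 0 < e ->
  exists z,
    [/\ lipschitz_by 1 z, forall x, r <= mdist x p -> z x = 0,
     exists x y, [/\ x != y, mdist x p < r, mdist y p < r &
       mdist x y <= `|z x - z y| ] &
     forall f, lipschitz_by 1 f -> exists g,
      [/\ forall x, r <= mdist x p -> g x = f x,
          lipschitz_by (1 + e) g,
          lipschitz_by (1 + e) (fun x => g x + z x),
          lipschitz_by (1 + e) (fun x => g x - z x) &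
          exists x y, [/\ x != y, mdist x p < r, mdist y p < r,
            mdist x y <= `|g x - g y| &
            mdist x y <= `|(f x - g x) - (f y - g y)| ]]].
Proof.
move=> pl r0 e0.
pose k := Num.min (e / 3) 1.
have [k0 k3 k1] : [/\ 0 < k, 3 * k <= e & k <= 1].
  by rewrite /k; case: (leP (e / 3) 1) => h; split; lra.
(* [ramp k r] vanishes up to [c * r]. *)
pose c := k / (1 + k).
have cE : (1 + k) * c = k by rewrite /c mulrCA divff ?mulr1//; lra.
have cle a b : a <= c * b -> (1 + k) * a <= k * b.
  by move=> h; rewrite -[X in _ <= X * b]cE -mulrA ler_wpM2l//; lra.
have c0 : 0 < c by rewrite /c divr_gt0//; lra.
have c1 : c < 1 by nra.
(* The plateau has radius [s], realized by [q]; the factor [c * c] makes it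
   small compared with the ball of radius [c * r] on which [f] is flattened. *)
have [q [qp qr]] := limit_point_near pl (mulr_gt0 c0 (mulr_gt0 c0 r0)).
set s := mdist q p in qr; have s0 : 0 < s by rewrite mdist_gt0.
(* The cone has radius [t], again small compared with the top of the plateau. *)
have [q' [qp' qs]] := limit_point_near pl (mulr_gt0 c0 (mulr_gt0 c0 s0)).
set t := mdist q' p in qs; have t0 : 0 < t by rewrite mdist_gt0.
have cr : c * r < r by nra.
have cs : c * s < s by nra.
have ccr : c * (c * r) < c * r by nra.
have ccs : c * (c * s) < c * s by nra.
pose z x := Num.max 0 (t - mdist x p).
have zout x : t <= mdist x p -> z x = 0 by move=> h; apply/max_idPl; lra.
have zle x : `|z x| <= t.
  rewrite /z ger0_norm ?le_max ?lexx// ge_max (ltW t0)/=.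
  by have := mdist_ge0 x p; lra.
have z1 : lipschitz_by 1 z.
  apply: (@lipschitz_by_comp_dist 1 p (fun d => Num.max 0 (t - d))) => // a b ab.
    by case: (leP 0 (t - b)); case: (leP 0 (t - a)); lra.
  by case: (leP 0 (t - b)); case: (leP 0 (t - a)); lra.
exists z; split => //.
- by move=> x h; apply: zout; lra.
- exists q', p; rewrite mdistxx -/t; split => //; first lra.
  rewrite zout// /z mdistxx subr0 (max_idPr _) ?(ltW t0)//.
  by rewrite sub0r normrN ger0_norm// ltW.
move=> f f1.
(* With this sign the plateau adds its slope between [q] and [p] to that of
   [f], so that [f - g], where [f] is flattened out of [g], has slope at
   least 1 there. *)
pose sg : R := if 0 <= f q - f p then 1 else -1.
have sgn : `|sg| = 1 by rewrite /sg; case: ifP; rewrite ?normrN normr1.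
pose w x := sg * plateau k s p x.
pose g0 := flatten k r p f.
have wl : lipschitz_by (1 + k) w.
  by move=> x y; rewrite /w -mulrBr normrM sgn mul1r; exact: plateau_lipschitz.
have g0E x : mdist x p <= c * r -> g0 x = f p.
  by move=> h; apply: flatten_center; exact: cle.
have wE x : mdist x p <= c * s -> w x = sg * s.
  by move=> h; rewrite /w plateau_center// ?(ltW s0)//; exact: cle.
pose g x := g0 x + w x.
have gc x : mdist x p <= c * s -> g x = f p + sg * s.
  by move=> h; rewrite /g wE// g0E//; lra.
have gl : lipschitz_by (1 + k + k) g.
  apply: (@lipschitz_by_add_local _ _ (c * r) s p); rewrite ?(ltW k0)//.
  - exact: flatten_lipschitz.
  - by move=> x h; rewrite !g0E// mdistxx; nra.
  - by move=> x h; rewrite /w plateau_out// mulr0.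
  - move=> x; rewrite /w normrM sgn mul1r.
    rewrite (le_trans (plateau_le _ _ _ _)) ?(ltW s0)//.
    have : (1 + k) * s <= k * (c * r) by exact: cle.
    lra.
  - lra.
have gzl v : lipschitz_by 1 v -> (forall x, t <= mdist x p -> v x = 0) ->
    (forall x, `|v x| <= t) -> lipschitz_by (1 + e) (fun x => g x + v x).
  move=> v1 vo vt; apply: (@lipschitz_byW (1 + k + k + k)); first lra.
  apply: (@lipschitz_by_add_local _ _ (c * s) t p); rewrite ?(ltW k0)//.
  - by apply: lipschitz_byW v1; lra.
  - by move=> x h; rewrite !gc// mdistxx; nra.
  - move=> x; apply: le_trans (vt x) _.
    have : (1 + k) * t <= k * (c * s) by exact: cle.
    lra.
  - lra.
exists g; split.
- by move=> x h; rewrite /g /g0 flatten_out// /w plateau_out ?mulr0 ?addr0//; lra.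
- by apply: lipschitz_byW gl; lra.
- exact: gzl.
- apply: gzl => [|x /zout ->|x]; first exact: lipschitz_byN.
    by rewrite oppr0.
  by rewrite normrN.
have gp : g p = f p + sg * s by apply: gc; rewrite mdistxx; nra.
have gq : g q = f p.
  by rewrite /g g0E ?(ltW (le_lt_trans qr _))// /w plateau_out// mulr0 addr0.
exists q, p; rewrite mdistxx -/s gp gq; split => //; first lra.
- by rewrite opprD addNKr normrN normrM sgn mul1r ger0_norm// ltW.
- rewrite (_ : _ - _ = (f q - f p) + sg * s); last ring.
  rewrite /sg; case: (leP 0 (f q - f p)) => h.
    by rewrite mul1r ger0_norm; lra.
  by rewrite mulN1r ltr0_norm; lra.
Qed.
End Surgery.

(** * Sequences equivalent to the unit vector basis of c_0 *)

Section C0Perturbation.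
Context {R : realType} {X : normedModType R}.
Implicit Types (u v : nat -> X) (a b e : R).

(** The perturbation changes a combination with coefficients at most [m] by at
    most [e * m]. *)
Lemma c0_equivalent_perturb u v a b e : e < a -> a <= b ->
  (forall (p : nat) (c : 'I_p -> R),
      a * \big[Num.max/0]_(j < p) `|c j| <= `|\sum_(j < p) c j *: u j|
      <= b * \big[Num.max/0]_(j < p) `|c j|) ->
  (forall p : nat, \sum_(j < p) `|v j - u j| <= e) ->
  c0_equivalent v.
Proof.
move=> ea ab uab vu; have e0 : 0 <= e by have := vu 0%N; rewrite big_ord0.
exists (a - e), (b + e); split; [lra|lra|move=> p c].
have /andP[lo hi] := uab p c.
set m := \big[Num.max/0]_(j < p) _ in lo hi *.
have cm j : `|c j| <= m by exact: le_bigmax.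
have m0 : 0 <= m by exact: bigmax_ge_id.
have d : `|\sum_(j < p) c j *: v j - \sum_(j < p) c j *: u j| <= e * m.
  rewrite -sumrB (le_trans (ler_norm_sum _ _ _))// mulrC.
  apply: le_trans (_ : \sum_(j < p) m * `|v j - u j| <= _).
    by apply: ler_sum => j _; rewrite -scalerBr normrZ ler_wpM2r.
  by rewrite -mulr_sumr ler_wpM2l.
have := lerB_normD (\sum_(j < p) c j *: u j)
  (\sum_(j < p) c j *: v j - \sum_(j < p) c j *: u j).
have := ler_normD (\sum_(j < p) c j *: u j)
  (\sum_(j < p) c j *: v j - \sum_(j < p) c j *: u j).
rewrite addrCA subrr addr0 mulrBl mulrDl => h1 h2.
by apply/andP; split; lra.
Qed.

End C0Perturbation.

Section Lip0Bumps.
Context {R : realType} {M : metricType R} (o : M).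
Implicit Types (f g h : lip0 o) (B : set M).

Lemma lip0D f g x : (f + g) x = f x + g x.
Proof. by rewrite -[lip0_val (f + g)]/(val (f + g)) raddfD. Qed.

Lemma lip0B f g x : (f - g) x = f x - g x.
Proof. by rewrite -[lip0_val (f - g)]/(val (f - g)) raddfB. Qed.

Lemma lip0_sum n (c : 'I_n -> R) (h : nat -> lip0 o) x :
  (\sum_(j < n) c j *: h j) x = \sum_(j < n) c j * h j x.
Proof.
rewrite -[lip0_val _]/(val (\sum_(j < n) c j *: h j)) linear_sum/= fct_sumE.
by apply: eq_bigr.
Qed.

Lemma lip0_exists (k : R) (f : M -> R) : lipschitz_by k f -> f o = 0 ->
  exists h : lip0 o, lip0_val h = f.
Proof.
move=> kf f0.
have fP : f \in lip0_pred o by apply/asboolP; split => //; exists k.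
by exists (Lip0 fP).
Qed.

Lemma norm_lip0_ge1 h (x y : M) : x != y ->
  mdist x y <= `|h x - h y| -> 1 <= `|h|.
Proof.
move=> xy; have := lip0_norm_lip h x y; rewrite -lip0_normE => h1 h2.
have d0 : 0 < mdist x y by rewrite mdist_gt0.
by rewrite -(ler_pM2r d0) mul1r (le_trans h2).
Qed.

(** The slope is required between two points of the support: both points then
    see no other function of a family with disjoint supports. *)
Definition bump B h := (forall x, ~ B x -> h x = 0) /\
  exists x y, [/\ x != y, B x, B y & mdist x y <= `|h x - h y|].

Lemma sum_disjoint_le (T : Type) (B : nat -> set T) (x : T) (n : nat) (t : R) :
  0 <= t -> (forall i j x, B i x -> B j x -> i = j) ->
  \sum_(j < n) (if `[< B j x >] then t else 0) <= t.
Proof.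
move=> t0 disj.
have [[i Bi]|nB] := pselect (exists i : 'I_n, B i x).
  rewrite (bigD1 i)//= asboolT// big1 ?addr0// => j ji.
  rewrite asboolF// => Bj; move/eqP: ji; apply; apply: val_inj; exact: disj Bj Bi.
by rewrite big1// => j _; rewrite asboolF// => Bj; apply: nB; exists j.
Qed.

(** Upper bound: for given [x] and [y], only the at most two functions whose
    supports contain [x] or [y] contribute. Lower bound: the pair of points in
    the [i]-th support sees the [i]-th coefficient alone. *)
Lemma disjoint_bumps_c0 (B : nat -> set M) (h : nat -> lip0 o) (K : R) :
  (forall i j x, B i x -> B j x -> i = j) ->
  (forall n, bump (B n) (h n)) -> (forall n, `|h n| <= K) ->
  forall (n : nat) (c : 'I_n -> R),
    1 * \big[Num.max/0]_(j < n) `|c j| <= `|\sum_(j < n) c j *: h j|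
    <= (2 * K) * \big[Num.max/0]_(j < n) `|c j|.
Proof.
move=> disj hB hK n c; have K0 : 0 <= K by exact: le_trans (hK 0%N).
set m := \big[Num.max/0]_(j < n) _.
have cm j : `|c j| <= m by exact: le_bigmax.
have m0 : 0 <= m by exact: bigmax_ge_id.
apply/andP; split.
  rewrite mul1r; apply: bigmax_le => // i _.
  have [_ [x [y [xy Bx By hxy]]]] := hB i.
  have d0 : 0 < mdist x y by rewrite mdist_gt0.
  have SE w : B i w -> (\sum_(j < n) c j *: h j) w = c i * h i w.
    move=> Bw; rewrite lip0_sum (bigD1 i)//= big1 ?addr0// => j ji.
    rewrite (hB j).1 ?mulr0// => Bj; move/eqP: ji; apply.
    by apply: val_inj; exact: disj Bj Bw.
  have := lip0_norm_lip (\sum_(j < n) c j *: h j) x y.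
  rewrite -lip0_normE !SE// -mulrBr normrM => le.
  by rewrite -(ler_pM2r d0); apply: le_trans le; rewrite ler_wpM2l.
rewrite lip0_normE; apply: lip0_norm_le => [|x y]; first by rewrite !mulr_ge0.
rewrite !lip0_sum -sumrB (le_trans (ler_norm_sum _ _ _))//.
have t0 : 0 <= K * m * mdist x y by rewrite !mulr_ge0 ?mdist_ge0.
have -> : 2 * K * m * mdist x y = K * m * mdist x y + K * m * mdist x y by ring.
apply: le_trans (lerD (sum_disjoint_le x n t0 disj) (sum_disjoint_le y n t0 disj)).
rewrite -big_split/=; apply: ler_sum => j _; rewrite -mulrBr normrM.
have le : `|c j| * `|h j x - h j y| <= K * m * mdist x y.
  rewrite (mulrC K) -mulrA ler_pM//.
  apply: le_trans (lip0_norm_lip _ x y) _; rewrite ler_wpM2r ?mdist_ge0//.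
  exact: hK.
have [Bx|Bx] := asboolP (B j x); have [By|By] := asboolP (B j y).
- by rewrite (le_trans le)// lerDl.
- by rewrite addr0.
- by rewrite add0r.
- by rewrite !(hB j).1// subrr normr0 mulr0 addr0.
Qed.

(** * The strong diameter two property *)

Lemma normalize_near g (e : R) : 1 <= `|g| <= 1 + e ->
  `| `|g|^-1 *: g | = 1 /\ `|g - `|g|^-1 *: g| <= e.
Proof.
move=> /andP[g1 ge].
have g0 : 0 < `|g| by exact: lt_le_trans g1.
have gu : `|g|^-1 * `|g| = 1 by rewrite mulVf ?gt_eqF.
split; first by rewrite normrZ ger0_norm ?invr_ge0.
rewrite -[X in X - _]scale1r -scalerBl normrZ -[X in _ * X]ger0_norm// -normrM.
by rewrite mulrBl gu mul1r ger0_norm; lra.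
Qed.

(** The surgery, read in [lip0 o]: since the ball misses [o], the functions keep
    the value 0 there. The lower bounds on [|g + z|] and [|g - z|] come from the
    upper ones, as [2 <= 2 * |g| <= |g + z| + |g - z|]. *)
Lemma lip0_one_ball p r e : limit_point [set: M] p -> 0 < r ->
  r <= mdist p o -> 0 < e ->
  exists z : lip0 o, [/\ `|z| = 1, bump [set x | mdist x p < r] z &
    forall f, `|f| = 1 -> exists g y,
      [/\ bump [set x | mdist x p < r] (f - g) /\ `|f - g| <= 2 + e,
          `|y| = 1, `|g - y| <= e,
          `| 1 - `|y + z| | <= 2 * e & `| 1 - `|y - z| | <= 2 * e]].
Proof.
move=> pl r0 rpo e0.
have rop : r <= mdist o p by rewrite metric_sym.
have [z [z1 zout zs zg]] := one_ball_surgery pl r0 e0.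
have [z' zE] := lip0_exists z1 (zout _ rop); subst z.
exists z'.
have z1' : `|z'| <= 1 by exact: lip0_norm_le.
split.
- have [x [y [xy _ _ h]]] := zs; apply/le_anti/andP; split => //.
  exact: norm_lip0_ge1 h.
- split => [x /negP|]; first by rewrite -leNgt => /zout.
  by have [x [y [? ? ? ?]]] := zs; exists x, y.
move=> f f1; have fl : lipschitz_by 1 f.
  by move=> x y; have := lip0_norm_lip f x y; rewrite -lip0_normE f1.
have [g [gout gl gp gm [x [y [xy Bx By gxy fgxy]]]]] := zg _ fl.
have go : g o = 0 by rewrite gout// lip0_base.
have [g' gE] := lip0_exists gl go; subst g.
have e1 : 0 <= 1 + e by lra.
have gle : `|g'| <= 1 + e by exact: lip0_norm_le.
have gge : 1 <= `|g'| by exact: norm_lip0_ge1 gxy.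
have gpz : `|g' + z'| <= 1 + e.
  by apply: lip0_norm_le => // a b; rewrite !lip0D; exact: gp.
have gmz : `|g' - z'| <= 1 + e.
  by apply: lip0_norm_le => // a b; rewrite !lip0B; exact: gm.
have [yn gy] : `| `|g'|^-1 *: g' | = 1 /\ `|g' - `|g'|^-1 *: g'| <= e.
  by apply: normalize_near; rewrite gge.
have sum2 : 2 <= `|g' + z'| + `|g' - z'|.
  apply: le_trans (ler_normD _ _); rewrite addrACA subrr addr0 -mulr2n normrMn.
  by rewrite mulr2n; lra.
set y' := `|g'|^-1 *: g' in yn gy.
have close (w : lip0 o) : 1 - e <= `|g' + w| -> `|g' + w| <= 1 + e ->
    `|1 - `|y' + w| | <= 2 * e.
  move=> h1 h2; have := ler_dist_dist (g' + w) (y' + w).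
  rewrite opprD addrACA subrr addr0 => /le_trans/(_ gy).
  by rewrite ler_distl ler_distl => /andP[? ?]; apply/andP; split; lra.
exists g', y'; split => //; first split.
- split => [w /negP|]; first by rewrite -leNgt lip0B => /gout ->; rewrite subrr.
  by exists x, y; rewrite !lip0B.
- by apply: le_trans (ler_normB _ _) _; rewrite f1; lra.
- by apply: close => //; lra.
- by apply: close => //; lra.
Qed.

End Lip0Bumps.

Lemma sum_half_pow_le {R : realType} n : \sum_(j < n) (2^-1 : R) ^+ j.+2 <= 2^-1.
Proof.
suff -> : \sum_(j < n) (2^-1 : R) ^+ j.+2 = 2^-1 - 2^-1 ^+ n.+1.
  by rewrite gerBl exprn_ge0// invr_ge0.
elim: n => [|n IH]; first by rewrite big_ord0 expr1 subrr.
rewrite big_ord_recr/= IH !exprS; move: (2^-1 ^+ n) => t; lra.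
Qed.

Theorem mainTheorem5 (R : realType) (M : metricType R) (o : M) :
  infinite_set (limit_point [set: M]) -> sequential_SD2P (lip0 o).
Proof.
move=> infM m x m0 x1.
have [p [r [pl r0 ro disj]]] := infinite_disjoint_balls o infM.
pose B n := [set x | mdist x (p n) < r n].
pose e n : R := 2^-1 ^+ n.+2.
have e0 n : 0 < e n by rewrite exprn_gt0// invr_gt0.
have ecvg : 2 * e n @[n --> \oo] --> (0 : R).
  rewrite (_ : (fun n => 2 * e n) = geometric 2^-1 (2^-1)).
    by apply: cvg_geometric; rewrite ger0_norm ?invr_ge0// invf_lt1// ltr1n.
  by apply/funext => n; rewrite /e /geometric/= !exprS; move: (2^-1 ^+ n) => t; lra.
have [z zP] := choice (fun n => lip0_one_ball (pl n) (r0 n) (ro n) (e0 n)).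
have z1 n : `|z n| = 1 by have [] := zP n.
have zB n : bump (B n) (z n) by have [] := zP n.
have /choice[gy gyP] : forall ni : nat * 'I_m, exists gy : lip0 o * lip0 o,
    [/\ bump (B ni.1) (x ni.2 - gy.1) /\ `|x ni.2 - gy.1| <= 2 + e ni.1,
        `|gy.2| = 1, `|gy.1 - gy.2| <= e ni.1,
        `| 1 - `|gy.2 + z ni.1| | <= 2 * e ni.1 &
        `| 1 - `|gy.2 - z ni.1| | <= 2 * e ni.1].
  move=> [n i]; have [_ _ /(_ _ (x1 i))[g [y h]]] := zP n.
  by exists (g, y).
pose g n i := (gy (n, i)).1; pose y n i := (gy (n, i)).2.
have to1 (u : nat -> R) : (forall n, `|1 - u n| <= 2 * e n) ->
    u n @[n --> \oo] --> (1 : R).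
  move=> ue; apply/cvgrPdist_le => d d0.
  have /cvgrPdist_le/(_ d d0) := ecvg; apply: filterS => n; apply: le_trans.
  by rewrite sub0r normrN (le_trans (ue n))// ler_norm.
exists (fun i n => y n i), z; split.
- by split => // i n; have [] := gyP (n, i).
- move=> i; right.
  have c0g : forall n (c : 'I_n -> R),
    1 * \big[Num.max/0]_(j < n) `|c j| <= `|\sum_(j < n) c j *: (x i - g j i)|
    <= (2 * 3) * \big[Num.max/0]_(j < n) `|c j|.
    apply: (@disjoint_bumps_c0 _ _ _ B (fun n => x i - g n i)) => // n.
      by have [[]] := gyP (n, i).
    have [[_ h] _ _ _ _] := gyP (n, i); apply: le_trans h _ => /=.
    have : e n <= 1 by rewrite exprn_ile1 ?invr_ge0// invf_le1// ler1n.
    lra.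
  apply: (@c0_equivalent_perturb _ _ (fun n => x i - g n i) _ 1 (2 * 3) 2^-1
    _ _ c0g); [lra|lra|move=> n].
  apply: le_trans (sum_half_pow_le n); apply: ler_sum => j _.
  rewrite /= opprB addrC addrA subrK; by have [] := gyP (val j, i).
- exists 1, (2 * 1); split; [by []|lra|].
  by apply: (disjoint_bumps_c0 disj zB) => n; rewrite z1.
- by move=> i; split; apply: to1 => n; have [] := gyP (n, i).
Qed.
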